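(* Let $ABCD$ be a quadrilateral (a simple polygon with consecutive vertices $A,B,C,D$) such that the diagonal $AC$ lies in it and divides it into the two triangles $ABC$ and $ACD$, and these two triangles have equal area. Let $O$ be the midpoint of $AC$. Let $f\colon ABCD\to\mathbb{R}$ be a function whose restrictions to the triangles $ABC$ and $ACD$ are convex. Then $$\operatorname{Avg}(f,ABCD)\le\frac13\left(\frac{f(B)+f(D)}{2}+2\operatorname{Avg}(f,AC)\right)\le\frac13\left(\frac{f(B)+f(D)}{2}+f(A)+f(C)\right),$$ and $$\operatorname{Avg}(f,ABCD)\le\frac{f(O)}{3}+\frac23\cdot\frac{\operatorname{Avg}(f,AB)+\operatorname{Avg}(f,BC)+\operatorname{Avg}(f,CD)+\operatorname{Avg}(f,DA)}{4}\le\frac{f(O)}{3}+\frac23\cdot\frac{f(A)+f(B)+f(C)+f(D)}{4}.$$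
   Context: For a set $U$ which is a $k$-dimensional object (segment, polygon, etc.) and an integrable $f$, $\operatorname{Avg}(f,U)=\frac{1}{\operatorname{Vol}_k(U)}\int_U f$, where $\operatorname{Vol}_k$ is $k$-dimensional measure (length, area). For points $X,Y,\dots$ we write $\operatorname{Avg}(f,XY\dots)$ for $\operatorname{Avg}(f,\operatorname{conv}\{X,Y,\dots\})$; e.g. $\operatorname{Avg}(f,AC)$ is the average of $f$ over the segment $AC$ with respect to length, and $\operatorname{Avg}(f,ABCD)$ is the average over the quadrilateral with respect to area. *)

(* Defs.v *)
From HB Require Import structures.
From mathcomp Require Import all_boot all_order all_algebra.
From mathcomp Require Import all_classical all_reals all_analysis.
Set Implicit Arguments. Unset Strict Implicit. Unset Printing Implicit Defensive.
Import Order.TTheory GRing.Theory Num.Theory.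
Local Open Scope classical_set_scope.
Local Open Scope ring_scope.

Section Defs.
Variable R : realType.

Definition pt2 := (R * R)%type.

Definition area : set pt2 -> \bar R :=
  ((@lebesgue_measure R) \x (@lebesgue_measure R))%E.

Definition lerp (X Y : pt2) (t : R) : pt2 :=
  ((1 - t) * X.1 + t * Y.1, (1 - t) * X.2 + t * Y.2).

Definition midpoint (X Y : pt2) : pt2 := lerp X Y (2^-1).

Definition triangle (X Y Z : pt2) : set pt2 :=
  [set p | exists a b c : R, [/\ 0 <= a, 0 <= b, 0 <= c, a + b + c = 1 &
     p = (a * X.1 + b * Y.1 + c * Z.1, a * X.2 + b * Y.2 + c * Z.2)]].

(* 2*signed area of XYZ *)
Definition cross (X Y Z : pt2) : R :=
  (Y.1 - X.1) * (Z.2 - X.2) - (Y.2 - X.2) * (Z.1 - X.1).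

Definition convex_on (S : set pt2) (f : pt2 -> R) : Prop :=
  forall x y t, S x -> S y -> 0 <= t <= 1 ->
    f (lerp x y t) <= (1 - t) * f x + t * f y.

Definition avg2 (f : pt2 -> R) (U : set pt2) : R :=
  Rintegral area U f / fine (area U).

(* average of f over the segment XY w.r.t. length (X <> Y):
   the segment is parametrized at constant speed by t in [0,1] *)
Definition avg_seg (f : pt2 -> R) (X Y : pt2) : R :=
  Rintegral (@lebesgue_measure R) `[0, 1]%classic (fun t => f (lerp X Y t)).

End Defs.

(* Main.v *)
Require Import Defs.
From HB Require Import structures.
From mathcomp Require Import all_boot all_order all_algebra.
From mathcomp Require Import all_classical all_reals all_analysis.
From mathcomp Require Import measurable_realfun ring lra.
Import Order.TTheory GRing.Theory Num.Theory.
Import numFieldNormedType.Exports.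
Local Open Scope classical_set_scope.
Local Open Scope ring_scope.
Set Implicit Arguments. Unset Strict Implicit. Unset Printing Implicit Defensive.

(* For a triangle XYZ, write its points as (1 - s) X + s L(t) with L(t) on YZ.
   Convexity on the segment from X to L(t) and the Jacobian, proportional to s,
   give Avg(f, XYZ) <= f(X) / 3 + 2/3 Avg(f, YZ).  Applying this to ABC and ACD
   with apexes B and D gives the first bound; applying it to the four triangles
   OAB, OBC, OCD, ODA of equal area with apex O gives the second one.  The outer
   inequalities are the bound of the average of a convex function on a segment by
   the mean of its endpoint values. *)

(** * Affine change of variables for nonnegative functions *)

Section affine_substitution.
Context {R : realType}.
Local Notation mu := (@lebesgue_measure R).
Local Notation ft1 := (@fubini_tonelli1 _ _ _ _ R mu mu).
Local Notation ft2 := (@fubini_tonelli2 _ _ _ _ R mu mu).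
Local Open Scope ereal_scope.

Section affine1.
Variables a b : R.
Hypothesis a0 : (a != 0)%R.

Let phi : R -> measurableTypeR R := (fun x : R => a * x + b)%R.

Let mphi : measurable_fun [set: R] phi.
Proof. by apply: measurable_funD => //; exact: measurable_funM. Qed.

Let a_ge0 : (0 <= `|a|)%R. Proof. by []. Qed.

(* The instance is named because inference cannot find the proof [mphi]. *)
Let phimu : {measure set (measurableTypeR R) -> \bar R} :=
  measure_function_pushforward__canonical__measure_function_Measure mu mphi.

Let nu : {measure set (measurableTypeR R) -> \bar R} :=
  mscale (NngNum a_ge0) phimu.

(** Uniqueness of Lebesgue measure reduces this to half-open intervals. Their preimages are again
    intervals, with the closed end switching sides when [a < 0]. *)
Let lebesgue_measure_affine (A : set R) : measurable A -> mu A = nu A.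
Proof.
move=> mA; apply: lebesgue_measure_unique => // _ [[x y] _ <-] /=.
rewrite /mscale/= /pushforward.
have [a_gt0|a_lt0] : (0 < a)%R \/ (a < 0)%R.
  by move: a0; rewrite neq_lt => /orP[]; [right|left].
- have -> : phi @^-1` `]x, y] = `]((x - b) / a)%R, ((y - b) / a)%R]%classic.
    apply/seteqP; split => z /=;
      by rewrite !in_itv/= ltr_pdivrMr// ler_pdivlMr// ltrBlDr lerBrDr mulrC.
  rewrite !lebesgue_measure_itv/= !lte_fin ltr_pM2r ?invr_gt0// ltrD2r.
  case: ifPn => _; last by rewrite mule0.
  by rewrite -!EFinB -EFinM gtr0_norm//; congr EFin; field.
- have -> : phi @^-1` `]x, y] = `[((y - b) / a)%R, ((x - b) / a)%R[%classic.
    apply/seteqP; split => z /=;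
      by rewrite !in_itv/= ler_ndivrMr// ltr_ndivlMr// ltrBlDr lerBrDr mulrC andbC.
  rewrite !lebesgue_measure_itv/= !lte_fin ltr_nM2r ?invr_lt0// ltrD2r.
  case: ifPn => _; last by rewrite mule0.
  by rewrite -!EFinB -EFinM ltr0_norm//; congr EFin; field.
Qed.

Lemma ge0_integral_affine (F : R -> \bar R) :
  measurable_fun [set: R] F -> (forall x, 0 <= F x) ->
  \int[mu]_x F x = `|a|%:E * \int[mu]_x F (a * x + b)%R.
Proof.
move=> mF F0.
rewrite (eq_measure_integral nu); last by move=> A mA _; exact: lebesgue_measure_affine.
by rewrite ge0_integral_mscale// ge0_integral_pushforward.
Qed.

End affine1.

Definition affine2 (a b c d e g : R) (z : R * R) : R * R :=
  (a * z.1 + b * z.2 + e, c * z.1 + d * z.2 + g)%R.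

Lemma measurable_affine2 (a b c d e g : R) :
  measurable_fun [set: R * R] (affine2 a b c d e g).
Proof.
by apply: measurable_fun_pair; apply: measurable_funD => //;
  apply: measurable_funD; apply: measurable_funM.
Qed.

Lemma ge0_integral_affine2 (a b c d e g : R) (F : R * R -> \bar R) :
  (a * d - b * c != 0)%R ->
  measurable_fun [set: R * R] F -> (forall z, 0 <= F z) ->
  \int[mu \x mu]_z F z =
    `|a * d - b * c|%:E * \int[mu \x mu]_z F (affine2 a b c d e g z).
Proof.
(* Substituting first in x, then in y; swapping the outputs reduces a = 0 to c != 0. *)
wlog a0 : a b c d e g F / (a != 0)%R => [hwlog|].
  have [a0|a0] := eqVneq a 0%R; last exact: hwlog.
  move=> det0 mF F0.
  have c0 : (c != 0)%R by apply: contraNneq det0 => ->; rewrite a0; apply/eqP; ring.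
  have mFs : measurable_fun [set: R * R] (F \o unstable.swap).
    exact: measurableT_comp mF (@measurable_swap _ _ R R).
  transitivity (\int[mu \x mu]_z (F \o unstable.swap) z).
    by rewrite (ft1 F)// (ft2 (F \o unstable.swap))// => z; exact: F0.
  rewrite (hwlog c d a b g e (F \o unstable.swap))//; last 2 first.
  - by rewrite -oppr_eq0 opprB mulrC (mulrC c).
  - by move=> z; exact: F0.
  by congr (_%:E * _); rewrite distrC (mulrC a) (mulrC b).
move=> det0 mF F0.
have mG : measurable_fun [set: R * R] (F \o affine2 a b c d e g).
  exact: measurableT_comp mF (measurable_affine2 a b c d e g).
have G0 z : 0 <= (F \o affine2 a b c d e g) z by exact: F0.
rewrite [in RHS](ft2 (F \o affine2 a b c d e g))//.
pose D := (a * d - b * c)%R.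
(* [H] is [F] on the image of [affine2] with the first output taken as the new variable [x];
   eliminating the old one leaves slope [D / a] in [y]. The two one-variable Jacobians are thus [a]
   and [D / a], with product [D]. *)
pose H (x y : R) := F (x, c / a * x + (D / a * y + (g - c / a * e)))%R.
have H0 x y : 0 <= H x y by exact: F0.
have mpair (p q r : R) : measurable_fun [set: R * R]
    (fun z => (z.1, p * z.1 + (q * z.2 + r)))%R.
  apply: measurable_fun_pair => //; apply: measurable_funD.
    exact: measurable_funM.
  by apply: measurable_funD => //; exact: measurable_funM.
have mH : measurable_fun [set: R * R] (fun z => H z.1 z.2).
  by apply: measurableT_comp => //; exact: mpair.
have inner y : \int[mu]_x F (affine2 a b c d e g (x, y)) =
    `|a|^-1%:E * \int[mu]_x H x y.
  rewrite (@ge0_integral_affine a (b * y + e)%R a0 (H^~ y))//; last first.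
    exact: (@measurable_fun_pair1 _ _ _ R R _ (fun z => H z.1 z.2) y mH).
  rewrite muleA -EFinM mulVf ?normr_eq0// mul1e.
  apply: eq_integral => x _; rewrite /H /affine2 /=; congr (F (_, _)).
    by ring.
  by rewrite /D; field.
rewrite /fubini_G; under [in RHS]eq_integral do rewrite inner.
rewrite ge0_integralZl//; last 2 first.
- exact: (@measurable_fun_fubini_tonelli_G _ _ _ _ R mu (fun z => H z.1 z.2) mH).
- by move=> y _; exact: integral_ge0.
rewrite -(@fubini_tonelli _ _ _ _ R mu mu (fun z => H z.1 z.2))// (ft1 F)//.
have inner2 x : \int[mu]_y F (x, y) = (`|D / a|)%:E * \int[mu]_y H x y.
  have Da0 : (D / a != 0)%R by rewrite mulf_neq0 ?invr_eq0.
  rewrite (@ge0_integral_affine _ (c / a * x + (g - c / a * e))%R Da0)//.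
  - congr (_ * _); apply: eq_integral => y _; rewrite /H; congr (F (_, _)).
    by ring.
  - exact: (@measurable_fun_pair2 _ _ _ R R _ F x mF).
rewrite /fubini_F; under eq_integral do rewrite inner2.
rewrite ge0_integralZl//; last 2 first.
- exact: (@measurable_fun_fubini_tonelli_F _ _ _ _ R mu (fun z => H z.1 z.2) mH).
- by move=> y _; exact: integral_ge0.
by rewrite !muleA -!EFinM normrM normfV.
Qed.

End affine_substitution.

(** * Affine change of variables for integrable functions on the plane *)

Section affine2_integral.
Context {R : realType}.
Local Notation mu := (@lebesgue_measure R).
Local Notation leb2 := (mu \x mu)%E.
Local Open Scope ereal_scope.

(* [area] is integrated over [pt2 R = R * R] with the default measurable structure
   of [R], but [lebesgue_measure] lives on [measurableTypeR R]; the two structures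
   have the same measurable sets and different displays, hence are not convertible.
   The identity map transports integrals from one to the other. *)
Lemma integrable_leb2 (D : set (pt2 R)) (f : pt2 R -> \bar R) : measurable D ->
  (@area R).-integrable D f -> leb2.-integrable D f.
Proof.
move=> mD /integrableP[mf foo]; apply/integrableP; split; first exact: mf.
have := @ge0_integral_pushforward _ _ (measurableTypeR R * measurableTypeR R)%type
  (R * R)%type R id (@measurable_id _ _ _) leb2 D (fun z => `|f z|) mD
  (measurableT_comp (@abse_measurable _ _) mf) (fun _ _ => abse_ge0 _).
by move=> h; rewrite -[ltLHS]h.
Qed.

Lemma integrable_leb2S (T S : set (pt2 R)) (g : pt2 R -> \bar R) :
  measurable T -> measurable S -> S `<=` T ->
  leb2.-integrable T g -> leb2.-integrable S g.
Proof. by move=> mT mS ST; exact: integrableS. Qed.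

Variables a b c d e g : R.
Hypothesis det0 : (a * d - b * c != 0)%R.
Let phi := affine2 a b c d e g.

Lemma measurable_preimage_affine2 (D : set (R * R)) :
  measurable D -> measurable (phi @^-1` D).
Proof.
by move=> mD; rewrite -[X in measurable X]setTI; exact: measurable_affine2.
Qed.

Lemma leb2_affine2 (D : set (R * R)) : measurable D ->
  leb2 D = `|a * d - b * c|%:E * leb2 (phi @^-1` D).
Proof.
move=> mD; have mE := measurable_preimage_affine2 mD.
have indicE (E : set (R * R)) : measurable E ->
    leb2 E = \int[leb2]_z (\1_E z)%:E.
  move=> mE'; have := @integral_indic _ _ R leb2 setT measurableT E mE'.
  by rewrite setIT => /esym.
rewrite !indicE// [in LHS](ge0_integral_affine2 e g det0)//.
exact/measurable_EFinP/measurable_indic.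
Qed.

Let patch_affine2 (D : set (R * R)) (f : R * R -> \bar R) :
  (f \_ D) \o phi = (f \o phi) \_ (phi @^-1` D).
Proof. by apply/funext => z; rewrite /= !patchE. Qed.

Lemma integrable_affine2 (D : set (R * R)) (f : R * R -> \bar R) :
  measurable D -> leb2.-integrable D f ->
  leb2.-integrable (phi @^-1` D) (f \o phi).
Proof.
move=> mD fi; apply/integrable_mkcond; first exact: measurable_preimage_affine2.
have /integrableP[mf foo] := iffLR (integrable_mkcond (mu := leb2) f mD) fi.
rewrite -patch_affine2; apply/integrableP; split.
  exact: measurableT_comp mf (measurable_affine2 a b c d e g).
move: foo; rewrite (ge0_integral_affine2 e g det0)//; last exact: measurableT_comp.
(* The determinant is nonzero, so an infinite integral after substitution would make the original
   one infinite. *)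
move=> h; rewrite ltey; apply: contraTneq h => h; rewrite [X in _ * X]h.
by rewrite gt0_muley ?lte_fin ?normr_gt0// ltxx.
Qed.

(** Positive and negative parts are substituted separately; integrability makes the Jacobian
    distribute over their difference. *)
Lemma integral_affine2 (D : set (R * R)) (f : R * R -> \bar R) :
  measurable D -> leb2.-integrable D f ->
  \int[leb2]_(z in D) f z =
  `|a * d - b * c|%:E * \int[leb2]_(z in phi @^-1` D) f (phi z).
Proof.
move=> mD fi; have fi' := integrable_affine2 mD fi.
have mE := measurable_preimage_affine2 mD.
rewrite integral_mkcond [in RHS]integral_mkcond -patch_affine2.
have /measurable_int mf := iffLR (integrable_mkcond (mu := leb2) f mD) fi.
rewrite integralE [in RHS]integralE.
rewrite (ge0_integral_affine2 e g det0)//; last exact: measurable_funepos.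
rewrite (ge0_integral_affine2 e g det0 (F := (f \_ D)^\-))//;
  last exact: measurable_funeneg.
have /(integrable_mkcond (mu := leb2) _ mE) := fi'; rewrite -patch_affine2 => fiT.
rewrite [RHS]muleBr//; last exact: integrable_add_def fiT.
by congr (_ * _ - _ * _); apply: eq_integral => z _; rewrite ?funepos_comp ?funeneg_comp.
Qed.

End affine2_integral.

(** * Quadratic and convex functions on the unit interval *)

Section unit_interval.
Context {R : realType}.
Local Notation mu := (@lebesgue_measure R).

Lemma integral01_poly (p : {poly R}) :
  (\int[mu]_(x in `[0%R, 1%R]) ((p^`()).[x])%:E = (p.[1] - p.[0])%:E)%E.
Proof.
rewrite (@continuous_FTC2 _ _ (fun x => p.[x])) ?EFinB//.
- by apply: continuous_subspaceT => x; exact: continuous_horner.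
- split=> [x _| |].
  + exact: derivable_horner.
  + by apply: cvg_at_right_filter; exact: continuous_horner.
  + by apply: cvg_at_left_filter; exact: continuous_horner.
- by move=> x _; rewrite derivE.
Qed.

Lemma integral01_quad (w u v : R) :
  (\int[mu]_(x in `[0%R, 1%R]) (w + u * x + v * x ^+ 2)%:E =
   (w + u / 2 + v / 3)%:E)%E.
Proof.
have := integral01_poly (w *: 'X + (u / 2) *: 'X^2 + (v / 3) *: 'X^3).
rewrite !hornerE /= ?expr1n ?expr0n/= ?mulr0 ?mulr1 ?addr0 ?subr0 => <-.
apply: eq_integral => x _; congr (_%:E).
rewrite !derivD !derivZ derivX !derivXn !hornerE/= ?hornerMn ?hornerXn /=; by field.
Qed.

Lemma integrable01_quad (w u v : R) :
  mu.-integrable `[0, 1] (EFin \o (fun x => w + u * x + v * x ^+ 2)).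
Proof.
apply: continuous_compact_integrable; first exact: segment_compact.
apply: continuous_subspaceT => x.
have -> : (fun x => w + u * x + v * x ^+ 2) = horner (w%:P + u *: 'X + v *: 'X^2).
  by apply/funext => y; rewrite !hornerE.
exact: continuous_horner.
Qed.

Definition convex01 (h : R -> R) := forall x y t,
  0 <= x <= 1 -> 0 <= y <= 1 -> 0 <= t <= 1 ->
  h ((1 - t) * x + t * y) <= (1 - t) * h x + t * h y.

Variable h : R -> R.
Hypothesis hc : convex01 h.

Let chord (x : R) : 0 <= x <= 1 -> h x <= (1 - x) * h 0 + x * h 1.
Proof.
move=> x01; have := hc (x := 0) (y := 1) (t := x).
by rewrite mulr0 add0r mulr1; apply; rewrite // lexx ler01.
Qed.

Lemma measurable_convex01 : measurable_fun `[0 : R, 1] h.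
Proof.
(* Sublevel sets are intervals. *)
move=> mD; apply: (measurability _ (RGenInftyO.measurableE R)) => //.
move=> _ [_ [c ->] <-]; apply: is_interval_measurable => x y /=.
rewrite !in_itv/= => -[x01 hx] [y01 hy] z /andP[xz zy]; split.
  by rewrite in_itv/=; move: x01 y01 => /andP[? ?] /andP[? ?]; apply/andP; split; lra.
rewrite in_itv/=; have [xy|yx] := ltP x y; last first.
  by rewrite (_ : z = x)//; apply/le_anti; rewrite xz andbT (le_trans zy).
have yx0 : 0 < y - x by rewrite subr_gt0.
pose t := (z - x) / (y - x).
have t01 : 0 <= t <= 1.
  by rewrite /t divr_ge0 ?subr_ge0// ?(ltW xy)//= ler_pdivrMr// mul1r lerD2r.
have -> : z = (1 - t) * x + t * y by rewrite /t; field; rewrite gt_eqF.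
apply: le_lt_trans (hc x01 y01 t01) _.
move: t01 => /andP[t0 t1].
(* Strictness needs a positive weight: at [t = 0] it comes from [h x < c], otherwise from
   [h y < c]. *)
have [t_eq0|t_neq0] := eqVneq t 0; first by rewrite t_eq0; lra.
have : 0 < t by rewrite lt_neqAle eq_sym t_neq0.
nra.
Qed.

(** A convex function may jump at the endpoints, so the argument rests on measurability and
    boundedness rather than continuity. *)
Lemma integrable_convex01 : mu.-integrable `[0, 1] (EFin \o h).
Proof.
apply: measurable_bounded_integrable => //.
- by rewrite /= lebesgue_measure_itv/= lte_fin ltr01 -EFinB ltry.
- exact: measurable_convex01.
(* The chord bounds [h x] and [h (1 - x)] above by the first two terms; the lower bound
   [2 * h (1/2) - h (1 - x)] accounts for the doubled third one. *)
- exists (`|h 0| + `|h 1| + `|h 2^-1| *+ 2); split; first exact: num_real.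
  move=> M hM x /=; rewrite in_itv/= => x01; apply: le_trans (ltW hM).
  have x01' : 0 <= 1 - x <= 1 by move: x01 => /andP[? ?]; apply/andP; split; lra.
  (* 1/2 is the midpoint of x and 1 - x, which bounds h x from below. *)
  have c1 := chord x01; have c2 := chord x01'.
  have : h 2^-1 <= (1 - 2^-1) * h x + 2^-1 * h (1 - x).
    rewrite [X in h X <= _](_ : _ = (1 - 2^-1) * x + 2^-1 * (1 - x)); last by field.
    by apply: hc => //; apply/andP; split; lra.
  move: (ler_norm (h 0)) (ler_norm (h 1)) (ler_normr (h 2^-1) (h 2^-1)).
  have := ler_norm (- h 0); have := ler_norm (- h 1); have := ler_norm (- h 2^-1).
  rewrite !normrN => ? ? ? ? ? _ mid; rewrite ler_norml.
  have := ler_norm (h 2^-1).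
  move: x01 => /andP[? ?]; rewrite mulr2n => ?; apply/andP; split; nra.
Qed.

(** The right half of the Hermite-Hadamard inequality: integrate the chord, seen as a quadratic with
    zero leading coefficient. *)
Lemma integral_convex01_le :
  Rintegral mu `[0, 1] h <= (h 0 + h 1) / 2.
Proof.
have -> : (h 0 + h 1) / 2 =
    Rintegral mu `[0, 1] (fun x => h 0 + (h 1 - h 0) * x + 0 * x ^+ 2).
  by rewrite /Rintegral integral01_quad/=; field.
apply: le_Rintegral => //; [exact: integrable_convex01|exact: integrable01_quad|].
by move=> x /=; rewrite in_itv/= => /chord; lra.
Qed.

End unit_interval.

(** * The apex-edge bound on a reference triangle *)

Section standard_triangle.
Context {R : realType}.
Local Notation mu := (@lebesgue_measure R).
Local Notation leb2 := (mu \x mu)%E.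

Lemma integral_affine (a b : R) (f : R -> \bar R) : a != 0 ->
  measurable_fun [set: R] f ->
  mu.-integrable [set: R] (fun x => f (a * x + b)) ->
  (\int[mu]_x f x = `|a|%:E * \int[mu]_x f (a * x + b)%R)%E.
Proof.
move=> a0 mf fi; pose phi x := a * x + b.
rewrite -[X in (_ * integral _ _ X)%E]/(f \o phi) integralE [in RHS]integralE.
rewrite (ge0_integral_affine b a0)//; last exact: measurable_funepos.
rewrite (ge0_integral_affine b a0 (F := (f^\-)%E))//; last exact: measurable_funeneg.
rewrite [RHS]muleBr//; last exact: integrable_add_def fi.
have -> : (fun x => f (phi x))^\+%E = (f^\+ \o phi)%E by rewrite -funepos_comp.
by have -> : (fun x => f (phi x))^\-%E = (f^\- \o phi)%E by rewrite -funeneg_comp.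
Qed.

Lemma measurable_nneg (f : R * R -> R) :
  measurable_fun [set: R * R] f -> measurable [set z | 0 <= f z].
Proof.
move=> mf; have -> : [set z | 0 <= f z] = setT `&` f @^-1` `[0, +oo[.
  by rewrite setTI; apply/seteqP; split => z /=; rewrite in_itv/= andbT.
exact: mf.
Qed.

(** The vertices are (0, 0), (1, 0) and (1, 1). The slice at abscissa s is s times the edge at
    abscissa 1, so slicing by the first coordinate is slicing by distance from the apex (0, 0). *)
Definition std_triangle : set (R * R) :=
  [set z | [/\ 0 <= z.2, z.2 <= z.1 & z.1 <= 1]].

Lemma measurable_std_triangle : measurable std_triangle.
Proof.
have -> : std_triangle = [set z | 0 <= z.2] `&` [set z | 0 <= z.1 - z.2]
    `&` [set z | 0 <= 1 - z.1].
  apply/seteqP; split => z; rewrite /std_triangle/= !subr_ge0; first by case.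
  by case=> -[].
apply: measurableI; first apply: measurableI; apply: measurable_nneg => //;
  exact: measurable_funB.
Qed.

Lemma leb2_std_triangle : leb2 std_triangle = (2^-1)%:E.
Proof.
rewrite /product_measure1.
transitivity (\int[mu]_(s in `[0%R, 1%R]) (0 + 1 * s + 0 * s ^+ 2)%:E)%E; last first.
  by rewrite integral01_quad; congr (_%:E); field.
rewrite [RHS]integral_mkcond; apply: eq_integral => s _.
rewrite /= patchE mem_setE in_itv/=; case: ifPn => [/andP[s0 s1]|s01].
  have -> : xsection std_triangle s = `[0, s]%classic.
    apply/seteqP; split => v; rewrite /xsection/= inE/= in_itv/=.
      by move=> [-> ->].
    by move=> /andP[].
  by rewrite lebesgue_measure_itv/= lte_fin; case: ltP => h;
    rewrite -?EFinB ?subr0; congr (_%:E); lra.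
have -> : xsection std_triangle s = set0; last by rewrite measure0.
apply/seteqP; split => v //; rewrite /xsection/= inE/= => -[v0 vs s1].
by move: s01; rewrite s1 (le_trans v0 vs).
Qed.

Section convex_bound.
Variable h : R * R -> R.
Hypothesis hc : convex_on std_triangle h.
Hypothesis hi : leb2.-integrable std_triangle (EFin \o h).

Local Notation I := (Rintegral mu `[0, 1]%classic (fun t => h (1, t))).
Let g : R * R -> \bar R := (EFin \o h) \_ std_triangle.

Let std_seg (s t : R) : 0 <= s <= 1 -> 0 <= t <= 1 -> std_triangle (s, s * t).
Proof. by move=> /andP[s0 s1] /andP[t0 t1]; split => //=; nra. Qed.

Let slice_convex (s : R) : 0 <= s <= 1 -> convex01 (fun t => h (s, s * t)).
Proof.
move=> s01 x y t x01 y01 t01.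
have := hc (std_seg s01 x01) (std_seg s01 y01) t01.
by congr (h _ <= _); rewrite /lerp/=; congr (_, _); ring.
Qed.

(** The point (s, s t) lies on the segment from the apex to (1, t), with weight s on the latter. *)
Let slice_le (s t : R) : 0 <= s <= 1 -> 0 <= t <= 1 ->
  h (s, s * t) <= (1 - s) * h (0, 0) + s * h (1, t).
Proof.
move=> s01 t01.
have z01 : 0 <= (0 : R) <= 1 by rewrite lexx ler01.
have o01 : 0 <= (1 : R) <= 1 by rewrite ler01 lexx.
have := hc (std_seg z01 t01) (std_seg o01 t01) s01.
by rewrite /lerp/= mul0r mul1r !mulr0 !add0r mulr1.
Qed.

Let edge_integrable : mu.-integrable `[0, 1] (EFin \o (fun t => h (1, t))).
Proof.
have o01 : 0 <= (1 : R) <= 1 by rewrite ler01 lexx.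
have := integrable_convex01 (slice_convex o01).
by congr (integrable _ _ _); apply/funext => t /=; rewrite mul1r.
Qed.

Let giT : leb2.-integrable setT g.
Proof. exact/(integrable_mkcond (mu := leb2) _ measurable_std_triangle). Qed.

(** Substituting v = s t brings a factor s, and [slice_le] then bounds the slice by s ((1 - s) h(0,
    0) + s I), expanded here in powers of s. *)
Let slice_integral (s : R) : 0 <= s <= 1 ->
  (\int[mu]_v g (s, v) <= (0 + h (0, 0) * s + (I - h (0, 0)) * s ^+ 2)%:E)%E.
Proof.
move=> /andP[]; rewrite le_eqVlt => /predU1P[<- _|s_gt0 s1].
  rewrite mulr0 expr0n/= mulr0 !addr0.
  (* At s = 0 the substitution degenerates, but the slice is a single point and both sides are 0. *)
  have -> : (fun v => g (0, v)) = (fun v => g (0, v)) \_ [set 0].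
    apply/funext => v; rewrite [RHS]patchE; case: ifPn => // v0.
    rewrite /g patchE; case: ifPn => //; rewrite inE => -[/= h1 h2 _].
    by move: v0; rewrite notin_setE/=; case; apply/le_anti; rewrite h1 h2.
  by rewrite -integral_mkcond integral_set1.
have s01 : 0 <= s <= 1 by rewrite (ltW s_gt0).
pose k t := h (s, s * t).
have ki : mu.-integrable `[0, 1] (EFin \o k).
  exact: integrable_convex01 (slice_convex s01).
have gk : (fun t => g (s, s * t + 0)) = (EFin \o k) \_ `[0, 1].
  apply/funext => t; rewrite /g !patchE addr0; congr (if _ then _ else _).
  rewrite mem_setE in_itv/=; apply/idP/idP; rewrite inE /std_triangle/=.
    by move=> [h1 h2 _]; move: h1 h2; rewrite pmulr_rge0// ger_pMr// => -> ->.
  by move=> /(std_seg s01).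
rewrite (@integral_affine s 0)//; [|by rewrite gt_eqF| |].
- rewrite gk -integral_mkcond gtr0_norm//.
  have kfin : (\int[mu]_(t in `[0%R, 1%R]) (k t)%:E)%E \is a fin_num.
    by apply: integrable_fin_num => //; exact: ki.
  rewrite -(fineK kfin) -EFinM lee_fin.
  have ei := edge_integrable.
  have ci : mu.-integrable `[0, 1] (EFin \o cst ((1 - s) * h (0, 0))).
    by have := integrable01_quad ((1 - s) * h (0, 0)) 0 0;
      congr (integrable _ _ _); apply/funext => t /=; rewrite !mul0r !addr0.
  have sei : mu.-integrable `[0, 1] (EFin \o (fun t => s * h (1, t))).
    by apply: (integrableZl _ s ei).
  have cE : Rintegral mu `[0, 1] (cst ((1 - s) * h (0, 0))) = (1 - s) * h (0, 0).
    by rewrite Rintegral_cst//= lebesgue_measure_itv/= lte_fin ltr01/= subr0 mulr1.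
  have : Rintegral mu `[0, 1] k <= (1 - s) * h (0, 0) + s * I.
    rewrite -RintegralZl// -[X in X + _]cE -RintegralD//; apply: le_Rintegral => //.
      by apply: (integrableD _ ci sei).
    by move=> t /=; rewrite in_itv/= => /(slice_le s01).
  move=> kI; rewrite [leRHS](_ : _ = s * ((1 - s) * h (0, 0) + s * I)); last by ring.
  by rewrite ler_wpM2l// ltW.
- have /measurable_int mg := giT.
  exact: (@measurable_fun_pair2 _ _ _ R R _ g s mg).
- rewrite gk; have m01 : measurable (`[0%R, 1%R]%classic : set (measurableTypeR R)).
    exact: measurable_itv.
  exact: (iffLR (integrable_mkcond (mu := mu) (EFin \o k) m01) ki).
Qed.

(** Integrating the slice bounds over s gives h(0, 0) (1/2 - 1/3) + I / 3. As the area is 1/2, these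
    are the weights 1/3 and 2/3 for the average. *)
Lemma integral_std_triangle_le :
  (\int[leb2]_(z in std_triangle) (h z)%:E <= (h (0, 0) / 6 + I / 3)%:E)%E.
Proof.
rewrite integral_mkcond -(integral12_prod_meas1 giT).
rewrite [X in (_ <= X)%E](_ : _ =
   \int[mu]_(s in `[0%R, 1%R]) (0 + h (0, 0) * s + (I - h (0, 0)) * s ^+ 2)%:E)%E; last first.
  by rewrite integral01_quad; congr (_%:E); field.
have -> : (\int[mu]_x fubini_F mu g x = \int[mu]_(x in `[0%R, 1%R]) fubini_F mu g x)%E.
  rewrite [RHS]integral_mkcond; apply: eq_integral => s _.
  rewrite patchE mem_setE in_itv/=; case: ifPn => // s01.
  rewrite /fubini_F integral0_eq// => v _; rewrite /g patchE.
  case: ifPn => //; rewrite inE => -[/= v0 vs s1].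
  by move: s01; rewrite s1 (le_trans v0 vs).
apply: le_integral => //.
- apply: (@integrableS _ _ R mu setT) => //.
  exact: (@integrable_fubini_F _ _ _ _ R mu mu g giT).
- exact: integrable01_quad.
- by move=> s; rewrite inE/= in_itv/= => /slice_integral.
Qed.

End convex_bound.
End standard_triangle.

(** * Transport of the bound to arbitrary nondegenerate triangles *)

Section triangles.
Context {R : realType}.
Local Notation mu := (@lebesgue_measure R).
Local Notation leb2 := (mu \x mu)%E.
Implicit Types (X Y Z P Q : pt2 R) (f : pt2 R -> R).

Lemma triangleC X Y Z : triangle X Y Z = triangle Y X Z.
Proof.
apply/seteqP; split => _ [a [b [c [a0 b0 c0 abc ->]]]];
  by exists b, a, c; split; rewrite // 1?[b + a]addrC// ![b * _ + _]addrC.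
Qed.

Lemma triangleR X Y Z : triangle X Y Z = triangle Y Z X.
Proof.
apply/seteqP; split => _ [a [b [c [a0 b0 c0 abc ->]]]].
  by exists b, c, a; split => //; [rewrite -abc|congr (_, _)]; ring.
by exists c, a, b; split => //; [rewrite -abc|congr (_, _)]; ring.
Qed.

Lemma triangle_lerp X Y Z (t : R) : 0 <= t <= 1 -> triangle X Y Z (lerp X Y t).
Proof.
move=> /andP[t0 t1]; exists (1 - t), t, 0; rewrite subr_ge0.
by split => //; [ring|rewrite /lerp; congr (_, _); ring].
Qed.

Lemma midpointC X Y : midpoint X Y = midpoint Y X.
Proof. by rewrite /midpoint /lerp; congr (_, _); field. Qed.

(** The median from [Y] cuts the triangle in two. Of the weights of [X] and [Z], the smaller one is
    matched with an equal part of the larger, and together they become the weight of the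
    midpoint. *)
Lemma triangle_midpoint X Y Z :
  triangle Y X Z = triangle (midpoint X Z) X Y `|` triangle (midpoint X Z) Y Z.
Proof.
apply/seteqP; split => [_ [b [a [c [b0 a0 c0 abc ->]]]]|].
  have [ac|/ltW ca] := leP a c; [right|left].
    exists (2 * a), b, (c - a); rewrite subr_ge0 mulr_ge0//.
    by split => //; [lra|rewrite /midpoint /lerp/=; congr (_, _); field].
  exists (2 * c), (a - c), b; rewrite subr_ge0 mulr_ge0//.
  by split => //; [lra|rewrite /midpoint /lerp/=; congr (_, _); field].
move=> _ [] [m [a [b [m0 a0 b0 mab ->]]]].
  exists b, (a + m / 2), (m / 2); rewrite addr_ge0 ?divr_ge0//.
  by split => //; [lra|rewrite /midpoint /lerp/=; congr (_, _); field].
exists a, (m / 2), (b + m / 2); rewrite addr_ge0 ?divr_ge0//.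
by split => //; [lra|rewrite /midpoint /lerp/=; congr (_, _); field].
Qed.

(* Sends std_triangle onto XYZ, with (0, 0) going to X and (1, t) to the point
   lerp Y Z t of the opposite edge. *)
Definition tri_map X Y Z : R * R -> R * R :=
  affine2 (Y.1 - X.1) (Z.1 - Y.1) (Y.2 - X.2) (Z.2 - Y.2) X.1 X.2.

Lemma tri_map_det X Y Z :
  (Y.1 - X.1) * (Z.2 - Y.2) - (Z.1 - Y.1) * (Y.2 - X.2) = cross X Y Z.
Proof. by rewrite /cross; ring. Qed.

(** The image of (s, v) has barycentric weights 1 - s, s - v, v, and [std_triangle] says exactly
    that these are nonnegative. *)
Lemma preimage_triangle X Y Z : cross X Y Z != 0 ->
  tri_map X Y Z @^-1` triangle X Y Z = std_triangle.
Proof.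
move=> K0; apply/seteqP; split => [[s v] /= [a [b [c [a0 b0 c0 abc]]]]|].
  rewrite /tri_map /affine2/= => -[e1 e2].
  have aE : a = 1 - b - c by lra.
  (* [d1] and [d2] are the residuals of the two coordinate equations; Cramer's rule combines them to
     isolate s and v, up to the nonzero factor [cross X Y Z]. *)
  pose d1 := (Y.1 - X.1) * s + (Z.1 - Y.1) * v + X.1
    - (a * X.1 + b * Y.1 + c * Z.1).
  pose d2 := (Y.2 - X.2) * s + (Z.2 - Y.2) * v + X.2
    - (a * X.2 + b * Y.2 + c * Z.2).
  have d10 : d1 = 0 by rewrite /d1 e1 subrr.
  have d20 : d2 = 0 by rewrite /d2 e2 subrr.
  have sE : s = b + c.
    apply: (mulfI K0); apply/eqP; rewrite -subr_eq0; apply/eqP.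
    transitivity ((Z.2 - Y.2) * d1 - (Z.1 - Y.1) * d2); last by rewrite d10 d20; ring.
    by rewrite /d1 /d2 /cross aE; ring.
  have vE : v = c.
    apply: (mulfI K0); apply/eqP; rewrite -subr_eq0; apply/eqP.
    transitivity ((Y.1 - X.1) * d2 - (Y.2 - X.2) * d1); last by rewrite d10 d20; ring.
    by rewrite /d1 /d2 /cross aE; ring.
  by split => /=; lra.
move=> [s v] [/= v0 vs s1]; exists (1 - s), (s - v), v; rewrite !subr_ge0.
by split => //; [ring|rewrite /tri_map /affine2/=; congr (_, _); ring].
Qed.

Lemma measurable_triangle X Y Z : cross X Y Z != 0 -> measurable (triangle X Y Z).
Proof.
move=> K0; pose K := cross X Y Z.
(* [psi] is the inverse of [tri_map X Y Z]; it replaces the existential description of the triangle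
   by a measurable preimage. *)
pose psi := affine2 ((Z.2 - Y.2) / K) (- (Z.1 - Y.1) / K)
  (- (Y.2 - X.2) / K) ((Y.1 - X.1) / K)
  (((Z.1 - Y.1) * X.2 - (Z.2 - Y.2) * X.1) / K)
  (((Y.2 - X.2) * X.1 - (Y.1 - X.1) * X.2) / K).
have -> : triangle X Y Z = psi @^-1` std_triangle.
  rewrite -(preimage_triangle K0) -comp_preimage [_ \o _](_ : _ = id)//.
  apply/funext => -[x y]; rewrite /tri_map /psi /affine2/=.
  by congr (_, _); rewrite /K /cross; field; rewrite -/(cross X Y Z).
by apply: measurable_preimage_affine2; exact: measurable_std_triangle.
Qed.

Lemma leb2_triangle X Y Z : cross X Y Z != 0 ->
  leb2 (triangle X Y Z) = (`|cross X Y Z| / 2)%:E.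
Proof.
move=> K0; have := leb2_affine2 (c := Y.2 - X.2) X.1 X.2 _ (measurable_triangle K0).
move=> /(_ (Y.1 - X.1) (Z.1 - Y.1) (Z.2 - Y.2)); rewrite tri_map_det => /(_ K0) ->.
by rewrite [_ @^-1` _](preimage_triangle K0) leb2_std_triangle -EFinM.
Qed.

(** Pulling back along [tri_map] preserves convexity, and its Jacobian is the absolute value of
    [cross X Y Z], twice the area of the triangle. *)
Lemma Rintegral_triangle_le X Y Z f : cross X Y Z != 0 ->
  leb2.-integrable (triangle X Y Z) (EFin \o f) ->
  convex_on (triangle X Y Z) f ->
  Rintegral leb2 (triangle X Y Z) f <=
    `|cross X Y Z| * (f X / 6 + avg_seg f Y Z / 3).
Proof.
move=> K0 fi fc; have mT := measurable_triangle K0.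
have det0 := K0; rewrite -tri_map_det in det0.
have pre := preimage_triangle K0.
have hi : leb2.-integrable std_triangle (EFin \o (f \o tri_map X Y Z)).
  by rewrite -pre; exact: (integrable_affine2 X.1 X.2 det0 mT fi).
have hc : convex_on std_triangle (f \o tri_map X Y Z).
  move=> x y t; rewrite -pre => Tx Ty t01; apply: le_trans (fc _ _ _ Tx Ty t01).
  rewrite le_eqVlt; apply/orP; left; apply/eqP.
  by congr f; rewrite /tri_map /affine2 /lerp/=; congr (_, _); ring.
have := integral_std_triangle_le hc hi.
have -> : (f \o tri_map X Y Z) (0, 0) = f X.
  by rewrite /tri_map /affine2/= !mulr0 !add0r -surjective_pairing.
have -> : Rintegral mu `[0, 1] (fun t => (f \o tri_map X Y Z) (1, t)) = avg_seg f Y Z.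
  apply: eq_Rintegral => t _; rewrite /tri_map /affine2 /lerp/=.
  by congr (f (_, _)); ring.
move=> le_std.
have fin : (\int[leb2]_(z in triangle X Y Z) (f z)%:E)%E \is a fin_num.
  by apply: integrable_fin_num; [exact: mT|exact: fi].
rewrite -lee_fin /Rintegral fineK//.
have := integral_affine2 X.1 X.2 det0 mT fi; rewrite [_ @^-1` _]pre tri_map_det => ->.
by rewrite EFinM lee_pmul2l// lte_fin normr_gt0.
Qed.

End triangles.

(** * Two triangles on opposite sides of a common edge *)

Section hinged_triangles.
Context {R : realType}.
Local Notation mu := (@lebesgue_measure R).
Local Notation leb2 := (mu \x mu)%E.
Implicit Types (X Y Z P Q : pt2 R) (f : pt2 R -> R).

Let line P Q : set (R * R) := [set p | cross P Q p = 0].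

Let measurable_line P Q : measurable (line P Q).
Proof.
have mc : measurable_fun [set: R * R] (cross P Q).
  by apply: measurable_funB; apply: measurable_funM => //; exact: measurable_funB.
have -> : line P Q = [set p | 0 <= cross P Q p] `&` [set p | 0 <= - cross P Q p].
  apply/seteqP; split => p /=; rewrite /line/= oppr_ge0; first by move=> ->.
  by move=> [? ?]; apply/le_anti/andP.
by apply: measurableI; apply: measurable_nneg => //; exact: measurableT_comp.
Qed.

(** In the coordinates of [tri_map P Q Z] the line is the horizontal axis, whose vertical slices are
    points. *)
Let leb2_line P Q Z : cross P Q Z != 0 -> leb2 (line P Q) = 0%E.
Proof.
move=> K0; have det0 := K0; rewrite -tri_map_det in det0.
rewrite (leb2_affine2 P.1 P.2 det0 (measurable_line P Q)).
rewrite (_ : _ @^-1` _ = [set z | z.2 = 0]); last first.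
  have cE z : cross P Q (tri_map P Q Z z) = z.2 * cross P Q Z.
    by rewrite /cross /tri_map /affine2/=; ring.
  apply/seteqP; split => z; rewrite /line/= [cross _ _ _]cE.
    by move/eqP; rewrite mulf_eq0 (negbTE K0) orbF => /eqP.
  by move=> ->; rewrite mul0r.
rewrite /product_measure1 integral0_eq ?mule0// => s _ /=.
rewrite (_ : xsection _ _ = [set 0]) ?lebesgue_measure_set1//.
by apply/seteqP; split => v; rewrite /xsection/= inE.
Qed.

(** [cross P Q] is affine and vanishes at [P] and [Q], so on each triangle it is a nonnegative
    multiple of its value at the apex. At a common point the product of the two expressions is both
    a square and nonpositive. *)
Let hingeI P Q X Y : cross P Q X * cross P Q Y < 0 ->
  triangle X P Q `&` triangle Y P Q `<=` line P Q.
Proof.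
move=> XY p [] [a [b [c [a0 b0 c0 abc pE]]]] [a' [b' [c' [a'0 b'0 c'0 abc' pE']]]].
have crossE (u v w : R) Z : u + v + w = 1 ->
    cross P Q (u * Z.1 + v * P.1 + w * Q.1, u * Z.2 + v * P.2 + w * Q.2) =
    u * cross P Q Z.
  by move=> uvw; rewrite /cross/= (_ : u = 1 - v - w); [ring|lra].
have h1 : cross P Q p = a * cross P Q X by rewrite pE crossE.
have h2 : cross P Q p = a' * cross P Q Y by rewrite pE' crossE.
have : 0 <= cross P Q p ^+ 2 by exact: sqr_ge0.
have : cross P Q p ^+ 2 <= 0.
  rewrite expr2 {1}h1 h2 mulrACA; apply: mulr_ge0_le0 (ltW XY).
  exact: mulr_ge0.
by move=> h3 h4; apply/eqP; rewrite -sqrf_eq0; apply/eqP/le_anti; rewrite h3 h4.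
Qed.

Variables P Q X Y : pt2 R.
Hypothesis XY : cross P Q X * cross P Q Y < 0.

Let KX : cross P Q X != 0.
Proof. by apply: contraTneq XY => ->; rewrite mul0r ltxx. Qed.

Let KY : cross P Q Y != 0.
Proof. by apply: contraTneq XY => ->; rewrite mulr0 ltxx. Qed.

Let crossR Z : cross Z P Q = cross P Q Z.
Proof. by rewrite /cross; ring. Qed.

Let mX : measurable (triangle X P Q).
Proof. by apply: measurable_triangle; rewrite crossR. Qed.

Let mY : measurable (triangle Y P Q).
Proof. by apply: measurable_triangle; rewrite crossR. Qed.

(** The triangles share the edge [P Q]; removing its null line makes them disjoint without changing
    any integral. *)
Lemma Rintegral_hinge f :
  leb2.-integrable (triangle X P Q `|` triangle Y P Q) (EFin \o f) ->
  Rintegral leb2 (triangle X P Q `|` triangle Y P Q) f =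
  Rintegral leb2 (triangle X P Q) f + Rintegral leb2 (triangle Y P Q) f.
Proof.
move=> fi; have mU : measurable (triangle X P Q `|` triangle Y P Q).
  exact: measurableU.
have mN := measurable_line P Q; have N0 := leb2_line KX.
have fX : leb2.-integrable (triangle X P Q) (EFin \o f).
  by apply: integrableS fi => //; exact: subsetUl.
have fY : leb2.-integrable (triangle Y P Q) (EFin \o f).
  by apply: integrableS fi => //; exact: subsetUr.
have off D : measurable D -> leb2.-integrable D (EFin \o f) ->
    Rintegral leb2 D f = Rintegral leb2 (D `\` line P Q) f.
  move=> mD fD; congr fine.
  exact: (@negligible_integral _ _ R leb2 D (line P Q) (EFin \o f) mN mD fD N0).
rewrite (off _ mU fi) (off _ mX fX) (off _ mY fY) setDUl Rintegral_setU//.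
- exact: measurableD.
- exact: measurableD.
- by apply: integrableS fi => //; rewrite -setDUl; [exact: measurableD|exact: subDsetl].
- apply/disj_setPS => p [[pX pN] [pY _]]; apply: pN; apply: (hingeI XY).
  by split.
Qed.

(** Inclusion-exclusion, the intersection being null as part of the common line. *)
Lemma leb2_hinge : leb2 (triangle X P Q `|` triangle Y P Q) =
  ((`|cross P Q X| + `|cross P Q Y|) / 2)%:E.
Proof.
have I0 : leb2 (triangle X P Q `&` triangle Y P Q) = 0%E.
  apply: (@subset_measure0 _ _ R leb2 _ (line P Q)).
  - exact: measurableI.
  - exact: measurable_line.
  - exact: hingeI.
  - exact: (leb2_line KX).
have aX : leb2 (triangle X P Q) = (`|cross P Q X| / 2)%:E.
  by rewrite leb2_triangle ?crossR.
have aY : leb2 (triangle Y P Q) = (`|cross P Q Y| / 2)%:E.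
  by rewrite leb2_triangle ?crossR.
have Xoo : (leb2 (triangle X P Q) < +oo)%E by rewrite aX ltry.
have UE : leb2 (triangle X P Q `|` triangle Y P Q) = (leb2 (triangle X P Q)
    + leb2 (triangle Y P Q) - leb2 (triangle X P Q `&` triangle Y P Q))%E.
  exact: (@measureUfinl _ _ R leb2 _ _ mX mY Xoo).
by rewrite UE I0 aX aY sube0 -EFinD -mulrDl.
Qed.

Lemma avg2_hinge f :
  leb2.-integrable (triangle X P Q `|` triangle Y P Q) (EFin \o f) ->
  `|cross P Q Y| = `|cross P Q X| ->
  avg2 f (triangle X P Q `|` triangle Y P Q) =
  (Rintegral leb2 (triangle X P Q) f + Rintegral leb2 (triangle Y P Q) f)
    / `|cross P Q X|.
Proof.
move=> fi KXY; rewrite -(Rintegral_hinge fi) /avg2; congr (_ / _).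
have -> : area (triangle X P Q `|` triangle Y P Q) = (`|cross P Q X|)%:E.
  by rewrite [LHS]leb2_hinge KXY; congr (_%:E); field.
by [].
Qed.

End hinged_triangles.

(** * Averages over segments, and the bound obtained by cutting along a median *)

Section segments.
Context {R : realType}.
Local Notation mu := (@lebesgue_measure R).
Local Notation leb2 := (mu \x mu)%E.
Implicit Types (A B C X Y : pt2 R) (f : pt2 R -> R).

Lemma avg_seg_le (S : set (pt2 R)) X Y f : convex_on S f ->
  (forall t, 0 <= t <= 1 -> S (lerp X Y t)) -> avg_seg f X Y <= (f X + f Y) / 2.
Proof.
move=> fc segS.
have hc : convex01 (fun t => f (lerp X Y t)).
  move=> x y t x01 y01 t01.
  apply: le_trans (fc _ _ _ (segS _ x01) (segS _ y01) t01).
  by rewrite le_eqVlt; apply/orP; left; apply/eqP; congr f;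
    rewrite /lerp/=; congr (_, _); ring.
have := integral_convex01_le hc.
have -> : lerp X Y 0 = X.
  by case: X {segS hc} => x1 x2; rewrite /lerp/=; congr (_, _); ring.
have -> // : lerp X Y 1 = Y.
by case: Y {segS hc} => y1 y2; rewrite /lerp/=; congr (_, _); ring.
Qed.

(** The median from [B] to [O] yields two triangles of half the area. The apex bound at [O] in each,
    with opposite edges [A B] and [B C], turns the weights 1/6 and 1/3 into halves, and the two
    copies of f(O) / 12 add up. *)
Lemma Rintegral_triangle_le_median A B C f : cross A C B != 0 ->
  leb2.-integrable (triangle B A C) (EFin \o f) ->
  convex_on (triangle B A C) f ->
  Rintegral leb2 (triangle B A C) f <=
    `|cross A C B| * (f (midpoint A C) / 6 + (avg_seg f A B + avg_seg f B C) / 6).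
Proof.
move=> K0 fi fc; set O := midpoint A C.
have TE := triangle_midpoint A B C; rewrite -/O in TE.
have sub1 : triangle O A B `<=` triangle B A C by rewrite TE; exact: subsetUl.
have sub2 : triangle O B C `<=` triangle B A C by rewrite TE; exact: subsetUr.
have mT : measurable (triangle B A C).
  by apply: measurable_triangle; rewrite (_ : cross _ _ _ = cross A C B)// /cross; ring.
have OAB : cross O A B = - (cross A C B / 2).
  by rewrite /O /midpoint /lerp /cross/=; field.
have OBC : cross O B C = - (cross A C B / 2).
  by rewrite /O /midpoint /lerp /cross/=; field.
have OAB0 : cross O A B != 0 by rewrite OAB oppr_eq0 mulf_neq0.
have OBC0 : cross O B C != 0 by rewrite OBC oppr_eq0 mulf_neq0.
(* [A] and [C] lie on opposite sides of the median, so the halves are hinged along [B O]. *)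
have opp : cross B O A * cross B O C < 0.
  rewrite (_ : cross B O A = cross O A B); last by rewrite /cross; ring.
  rewrite (_ : cross B O C = - cross O B C); last by rewrite /cross; ring.
  by rewrite OAB OBC mulrN oppr_lt0 mulrNN -expr2 exprn_even_gt0//= mulf_neq0.
have swapC : triangle O B C = triangle C B O by rewrite triangleC -triangleR.
have le1 := Rintegral_triangle_le OAB0
  (integrable_leb2S mT (measurable_triangle OAB0) sub1 fi)
  (fun x y t Tx Ty => fc x y t (sub1 _ Tx) (sub1 _ Ty)).
have le2 := Rintegral_triangle_le OBC0
  (integrable_leb2S mT (measurable_triangle OBC0) sub2 fi)
  (fun x y t Tx Ty => fc x y t (sub2 _ Tx) (sub2 _ Ty)).
move: le1 le2 fi; rewrite TE swapC [triangle O A B]triangleR => le1 le2 fi.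
rewrite (Rintegral_hinge opp fi); apply: le_trans (lerD le1 le2) _.
rewrite OAB OBC normrN normrM normfV (ger0_norm (ler0n _ 2)).
by rewrite le_eqVlt; apply/orP; left; apply/eqP; field.
Qed.

End segments.

(** * The four inequalities for the quadrilateral *)

Theorem theorem3p1 (R : realType) (A B C D : pt2 R) (f : pt2 R -> R) :
  (* B and D lie strictly on opposite sides of the line AC: ABCD is a simple
     quadrilateral whose diagonal AC lies inside it and splits it into the
     nondegenerate triangles ABC and ACD *)
  cross A C B * cross A C D < 0 ->
  (* the two triangles have equal area *)
  area (triangle A B C) = area (triangle A C D) ->
  (* f is integrable on the quadrilateral *)
  (@area R).-integrable (triangle A B C `|` triangle A C D) (EFin \o f) ->
  convex_on (triangle A B C) f ->
  convex_on (triangle A C D) f ->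
  let Q := triangle A B C `|` triangle A C D in
  let O := midpoint A C in
  [/\ avg2 f Q <= 3^-1 * ((f B + f D) / 2 + 2 * avg_seg f A C),
      3^-1 * ((f B + f D) / 2 + 2 * avg_seg f A C)
        <= 3^-1 * ((f B + f D) / 2 + f A + f C),
      avg2 f Q <= f O / 3 + 2 / 3 *
        ((avg_seg f A B + avg_seg f B C + avg_seg f C D + avg_seg f D A) / 4)
    & f O / 3 + 2 / 3 *
        ((avg_seg f A B + avg_seg f B C + avg_seg f C D + avg_seg f D A) / 4)
        <= f O / 3 + 2 / 3 * ((f A + f B + f C + f D) / 4)].
Proof.
(* The apexes [B] and [D] are put first, which shows the triangles as hinged along [A C]. *)
rewrite triangleC -(triangleR D A C) => BD eq_area fi fB fD Q O.
have KB : cross A C B != 0 by apply: contraTneq BD => ->; rewrite mul0r ltxx.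
have KD : cross A C D != 0 by apply: contraTneq BD => ->; rewrite mulr0 ltxx.
have BAC : cross B A C = cross A C B by rewrite /cross; ring.
have DAC : cross D A C = cross A C D by rewrite /cross; ring.
have BAC0 : cross B A C != 0 by rewrite BAC.
have DAC0 : cross D A C != 0 by rewrite DAC.
have mB := measurable_triangle BAC0; have mD := measurable_triangle DAC0.
have mQ : measurable Q by exact: measurableU.
have {}fi := integrable_leb2 mQ fi.
have fiB := integrable_leb2S mQ mB (@subsetUl _ _ _) fi.
have fiD := integrable_leb2S mQ mD (@subsetUr _ _ _) fi.
have eqK : `|cross A C D| = `|cross A C B|.
  have aB : area (triangle B A C) = (`|cross A C B| / 2)%:E.
    by rewrite -BAC; exact: leb2_triangle.
  have aD : area (triangle D A C) = (`|cross A C D| / 2)%:E.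
    by rewrite -DAC; exact: leb2_triangle.
  by move: eq_area; rewrite aB aD => -[]; lra.
have K_gt0 : 0 < `|cross A C B| by rewrite normr_gt0.
have avgE := avg2_hinge BD fi eqK.
split.
- have leB := Rintegral_triangle_le BAC0 fiB fB.
  have leD := Rintegral_triangle_le DAC0 fiD fD.
  rewrite BAC in leB; rewrite DAC eqK in leD.
  rewrite avgE ler_pdivrMr//; apply: le_trans (lerD leB leD) _.
  by rewrite le_eqVlt; apply/orP; left; apply/eqP; field.
- have : avg_seg f A C <= (f A + f C) / 2.
    by apply: (avg_seg_le fB) => t t01; rewrite triangleR; exact: triangle_lerp.
  by lra.
- have leB := Rintegral_triangle_le_median KB fiB fB.
  (* In the second triangle [A] and [C] are exchanged, so that the median bound produces the sides
     in the order [C D], [D A]; the midpoint [O] is unaffected. *)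
  have DE : triangle D C A = triangle D A C by rewrite triangleC triangleR.
  have CAD : cross C A D = - cross A C D by rewrite /cross; ring.
  have leD : Rintegral ((@lebesgue_measure R) \x (@lebesgue_measure R))%E
      (triangle D A C) f <=
      `|cross A C B| * (f O / 6 + (avg_seg f C D + avg_seg f D A) / 6).
    rewrite -eqK -[`|cross A C D|]normrN -CAD /O midpointC -DE.
    apply: Rintegral_triangle_le_median; rewrite ?DE ?CAD ?oppr_eq0//.
  rewrite avgE ler_pdivrMr//; apply: le_trans (lerD leB leD) _.
  by rewrite le_eqVlt; apply/orP; left; apply/eqP; field.
(* Each vertex is an endpoint of two sides, so the four endpoint means add up to the sum of the
   vertex values. *)
- have AB : avg_seg f A B <= (f A + f B) / 2.
    by apply: (avg_seg_le fB) => t t01; rewrite triangleC; exact: triangle_lerp.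
  have BC : avg_seg f B C <= (f B + f C) / 2.
    apply: (avg_seg_le fB) => t t01; rewrite triangleC triangleR.
    exact: triangle_lerp.
  have CD : avg_seg f C D <= (f C + f D) / 2.
    apply: (avg_seg_le fD) => t t01; rewrite triangleR triangleR.
    exact: triangle_lerp.
  have DA : avg_seg f D A <= (f D + f A) / 2.
    by apply: (avg_seg_le fD) => t t01; exact: triangle_lerp.
  by lra.
Qed.
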